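(* Let $\mathcal{S}$ be a first-order structure, fix a collection of isomorphisms as described in the context, and let $X \in \mathrm{Def}(\mathcal{S})$. The following are equivalent: (1) $2X \not\leq_0 X$; (2) there is a finitely additive invariant measure $\mu \colon \mathrm{Def}(\mathcal{S}) \to [0,\infty]$ such that $\mu(X) = 1$.
   Context: $\mathcal{S}=(S;\dots)$ is a first-order structure and ''definable'' means definable in $\mathcal{S}$ with parameters. $\mathrm{Def}(\mathcal{S})$ is the Boolean algebra of definable subsets of $S^n$ (for all $n$). For each $n$ one fixes a set $\mathcal{I}_n$ of ''isomorphisms'': a specified collection of definable bijections $S^n\to S^n$ closed under composition and inverses. For definable $X,Y$: $X\leq Y$ ($X$ isomorphically embeds into $Y$) means there is a finite definable partition $\{X_i\}$ of $X$ and isomorphisms $f_i$ with the sets $f_i(X_i)$ pairwise disjoint and $\bigcup_i f_i(X_i)\subseteq Y$; if moreover $\bigcup_i f_i(X_i)=Y$ we write $X\simeq Y$. $nX$ denotes the disjoint union of $n$ copies of $X$, and for positive integers $p,q$, $pX\leq qY$ is read accordingly. For $m>0$, $X\leq_m Y$ means there are positive integers $p,q$ with $m\leq p/q$ and $pX\leq qY$. $X\leq_0 Y$ means: for every $m>0$ there is a definable $X_0\subseteq X$ with $X_0\leq_m X$ and $(X\setminus X_0)\leq Y$. A finitely additive measure $\mu$ on $\mathrm{Def}(\mathcal{S})$ is invariant if $\mu(X)=\mu(Y)$ whenever $X\simeq Y$. *)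

(* Defs.v *)
From mathcomp Require Import all_boot all_order all_algebra.
From mathcomp Require Import all_classical all_reals all_analysis.

Set Implicit Arguments.
Unset Strict Implicit.
Unset Printing Implicit Defensive.

Import Order.TTheory GRing.Theory Num.Theory.

Local Open Scope classical_set_scope.
Local Open Scope ring_scope.

Record signature := Signature {
  fun_symbol : Type;
  fun_arity : fun_symbol -> nat;
  rel_symbol : Type;
  rel_arity : rel_symbol -> nat }.

Record structure (L : signature) := Structure {
  carrier :> Type;
  fun_interp : forall g : fun_symbol L,
    (fun_arity g).-tuple carrier -> carrier;
  rel_interp : forall r : rel_symbol L, set ((rel_arity r).-tuple carrier) }.

(* Terms and formulas are well-scoped: [formula L n] has its free variables
   among n de Bruijn indices, and a quantifier binds index 0. *)
Inductive term (L : signature) (n : nat) : Type :=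
| TVar of 'I_n
| TApp (g : fun_symbol L) (_ : 'I_(fun_arity g) -> term L n).

Inductive formula (L : signature) : nat -> Type :=
| FFalse n : formula L n
| FEq n of term L n & term L n : formula L n
| FRel n (r : rel_symbol L) (_ : 'I_(rel_arity r) -> term L n) : formula L n
| FImp n of formula L n & formula L n : formula L n
| FForall n of formula L n.+1 : formula L n.

Arguments TApp {L n} g _.
Arguments FRel {L n} r _.

Fixpoint eval (L : signature) (S : structure L) (n : nat) (v : n.-tuple S)
    (t : term L n) : S :=
  match t with
  | TVar i => tnth v i
  | TApp g args => fun_interp (mktuple (fun i => eval v (args i)))
  end.

Fixpoint sat (L : signature) (S : structure L) (n : nat) (phi : formula L n) :
    n.-tuple S -> Prop :=
  match phi in formula _ n return n.-tuple S -> Prop with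
  | FFalse _ => fun=> False
  | FEq _ t u => fun v => eval v t = eval v u
  | FRel _ r args => fun v => rel_interp (mktuple (fun i => eval v (args i)))
  | FImp _ phi1 phi2 => fun v => sat phi1 v -> sat phi2 v
  | FForall _ phi1 => fun v => forall a : S, sat phi1 (cons_tuple a v)
  end.

(* The tuple b lists the parameters. *)
Definition definable (L : signature) (S : structure L) (n : nat)
    (X : set (n.-tuple S)) : Prop :=
  exists (k : nat) (b : k.-tuple S) (phi : formula L (n + k)),
    X = [set x | sat phi (cat_tuple x b)].

Definition function_graph (T : Type) (n : nat) (f : n.-tuple T -> n.-tuple T) :
    set ((n + n).-tuple T) :=
  [set cat_tuple x (f x) | x in [set: n.-tuple T]].

Record isomorphisms (L : signature) (S : structure L) := Isomorphisms {
  iso :> forall n : nat, set (n.-tuple S -> n.-tuple S);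
  iso_bijective : forall n (f : n.-tuple S -> n.-tuple S),
    iso f -> bijective f;
  iso_definable : forall n (f : n.-tuple S -> n.-tuple S),
    iso f -> definable (function_graph f);
  iso_comp : forall n (f g : n.-tuple S -> n.-tuple S),
    iso f -> iso g -> iso (f \o g);
  iso_inv : forall n (f g : n.-tuple S -> n.-tuple S),
    iso f -> cancel f g -> cancel g f -> iso g }.

Section PiecewiseIsomorphisms.
Variables (L : signature) (S : structure L) (Iso : isomorphisms S) (n : nat).
Implicit Types I J : finType.

(* A family [A : I -> set (n.-tuple S)] stands for the formal disjoint union of
   the sets [A i].  An ordinary set is a family over [unit]. *)
Definition one_copy (X : set (n.-tuple S)) : unit -> set (n.-tuple S) := fun=> X.

Definition copies (p : nat) I (A : I -> set (n.-tuple S)) :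
  'I_p * I -> set (n.-tuple S) := fun i => A i.2.
Arguments copies p {I} A.

(* A finite definable partition of the disjoint union of A, together with
   isomorphisms sending the pieces to pairwise disjoint subsets of a disjoint
   union indexed by J.  The piece with index a lies in the summand [source a]
   and is moved by [move a] into the summand [target a]. *)
Record cutting I J (A : I -> set (n.-tuple S)) := Cutting {
  npieces : nat;
  piece : 'I_npieces -> set (n.-tuple S);
  source : 'I_npieces -> I;
  target : 'I_npieces -> J;
  move : 'I_npieces -> n.-tuple S -> n.-tuple S;
  piece_definable : forall a, definable (piece a);
  move_iso : forall a, Iso n (move a);
  piece_disjoint : forall i, trivIset [set a | source a = i] piece;
  piece_cover : forall i, \bigcup_(a in [set a | source a = i]) piece a = A i;
  image_disjoint : forall j,
    trivIset [set a | target a = j] (fun a => move a @` piece a) }.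

Definition cutting_image I J (A : I -> set (n.-tuple S)) (c : cutting J A)
    (j : J) : set (n.-tuple S) :=
  \bigcup_(a in [set a : 'I_(npieces c) | target a = j]) (move a @` piece a).

Definition embeds I J (A : I -> set (n.-tuple S)) (B : J -> set (n.-tuple S)) :=
  exists c : cutting J A, forall j, cutting_image c j `<=` B j.

Definition isomorphic I J (A : I -> set (n.-tuple S))
    (B : J -> set (n.-tuple S)) :=
  exists c : cutting J A, forall j, cutting_image c j = B j.

Definition embeds_mul (R : realType) (m : R) I J (A : I -> set (n.-tuple S))
    (B : J -> set (n.-tuple S)) :=
  exists p q : nat, [/\ (0 < p)%N, (0 < q)%N, m <= p%:R / q%:R
    & embeds (copies p A) (copies q B)].

Definition embeds0 (R : realType) I J (A : I -> set (n.-tuple S))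
    (B : J -> set (n.-tuple S)) :=
  forall m : R, 0 < m -> exists A0 : I -> set (n.-tuple S),
    [/\ forall i, definable (A0 i), forall i, A0 i `<=` A i,
        embeds_mul m A0 A & embeds (fun i => A i `\` A0 i) B].

End PiecewiseIsomorphisms.

Arguments copies {L S n} p {I} A.

(* A function on the definable sets of all dimensions is encoded as a total
   function whose values on non-definable sets are irrelevant. *)
Definition finitely_additive (R : realType) (L : signature) (S : structure L)
    (mu : forall n : nat, set (n.-tuple S) -> \bar R) : Prop :=
  [/\ forall n (A : set (n.-tuple S)), definable A -> (0 <= mu n A)%E,
      forall n, mu n set0 = 0%E
    & forall n (A B : set (n.-tuple S)), definable A -> definable B ->
        A `&` B = set0 -> mu n (A `|` B) = (mu n A + mu n B)%E].

Definition isom_invariant (R : realType) (L : signature) (S : structure L)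
    (Iso : isomorphisms S) (mu : forall n : nat, set (n.-tuple S) -> \bar R) :=
  forall n (A B : set (n.-tuple S)), definable A -> definable B ->
    isomorphic Iso (one_copy A) (one_copy B) -> mu n A = mu n B.

(* Main.v *)
(* If (k+1)X embeds into kX for some k, then NX embeds into kX for every N, so
   2X <=_m 2X for every m, and 2X <=_0 X holds by removing all of 2X.
   Otherwise consider, among the functions from S^n to the integers, the cone
   generated by nonnegative functions and by the differences 1_(f Q) - 1_Q, for f an isomorphism and Q a definable set that
   embeds into a multiple of X.  A cancellation argument shows that it does not
   contain -1_X.  A maximal cone with this property (Zorn) is a total preorder
   with unit 1_X, and Dedekind cuts in it give an additive, invariant state;
   sets that embed into no multiple of X get measure +oo. *)
Require Import Defs.
From mathcomp Require Import all_boot all_order all_algebra.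
From mathcomp Require Import all_classical all_reals all_analysis.
From mathcomp Require Import ring lra zify.

Set Implicit Arguments.
Unset Strict Implicit.
Unset Printing Implicit Defensive.

Import Order.TTheory GRing.Theory Num.Theory.
Local Open Scope classical_set_scope.

(** * Definable sets *)

Section Definability.
Variables (L : signature) (S : structure L).

Definition reindex n m (r : 'I_n -> 'I_m) (v : m.-tuple S) : n.-tuple S :=
  [tuple tnth v (r i) | i < n].

Definition lift_ren n m (r : 'I_n -> 'I_m) (i : 'I_n.+1) : 'I_m.+1 :=
  if unlift ord0 i is Some j then lift ord0 (r j) else ord0.

Lemma reindex_lift n m (r : 'I_n -> 'I_m) a (v : m.-tuple S) :
  reindex (lift_ren r) (cons_tuple a v) = cons_tuple a (reindex r v).
Proof.
apply: eq_from_tnth => i; rewrite tnth_mktuple /lift_ren.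
by case: unliftP => [j|] ->; rewrite ?tnthS ?tnth_mktuple ?tnth0.
Qed.

Fixpoint rename_term n m (r : 'I_n -> 'I_m) (t : term L n) : term L m :=
  match t with
  | TVar i => TVar L (r i)
  | TApp g args => TApp g (fun i => rename_term r (args i))
  end.

(** The target scope and the renaming come after [phi] because both change when the recursion passes
    under a quantifier. *)
Fixpoint rename n (phi : formula L n) : forall m, ('I_n -> 'I_m) -> formula L m :=
  match phi in formula _ n return forall m, ('I_n -> 'I_m) -> formula L m with
  | FFalse _ => fun m _ => FFalse L m
  | FEq _ t u => fun _ r => FEq (rename_term r t) (rename_term r u)
  | FRel _ R args => fun _ r => FRel R (fun i => rename_term r (args i))
  | FImp _ phi1 phi2 => fun _ r => FImp (rename phi1 r) (rename phi2 r)
  | FForall _ phi1 => fun _ r => FForall (rename phi1 (lift_ren r))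
  end.

Lemma eval_rename n m (r : 'I_n -> 'I_m) (v : m.-tuple S) (t : term L n) :
  Defs.eval v (rename_term r t) = Defs.eval (reindex r v) t.
Proof.
elim: t => [i|g args IH] /=; first by rewrite tnth_mktuple.
by congr fun_interp; apply: eq_from_tnth => i; rewrite !tnth_mktuple IH.
Qed.

Lemma sat_rename n (phi : formula L n) m (r : 'I_n -> 'I_m) (v : m.-tuple S) :
  sat (rename phi r) v <-> sat phi (reindex r v).
Proof.
elim: phi m r v => {n} [n|n t u|n R args|n p IHp q IHq|n p IHp] m r v //=.
- by rewrite !eval_rename.
- suff -> : [tuple Defs.eval v (rename_term r (args i)) | i < _] =
            [tuple Defs.eval (reindex r v) (args i) | i < _] by [].
  by apply: eq_from_tnth => i; rewrite !tnth_mktuple eval_rename.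
- by rewrite IHp IHq.
- by split=> H a; [rewrite -reindex_lift -IHp|rewrite IHp reindex_lift].
Qed.

(** The defining formula is renamed by [r] on its variables and by the identity on the block of
    parameters. *)
Lemma definable_reindex n m (r : 'I_n -> 'I_m) (A : set (n.-tuple S)) :
  definable A -> definable [set v | A (reindex r v)].
Proof.
case=> k [b [phi ->]]; exists k, b.
exists (rename phi (fun i => match fintype.split i with
                             | inl j => lshift k (r j) | inr j => rshift m j end)).
set r' := fun i : 'I_(n + k) => _.
have e v : reindex r' (cat_tuple v b) = cat_tuple (reindex r v) b.
  apply: eq_from_tnth => i; rewrite tnth_mktuple -(fintype.splitK i) /r'.
  by case: (fintype.split i) => j;
    rewrite unsplitK /= ?tnth_lshift ?tnth_rshift ?tnth_mktuple.
by apply/seteqP; split=> v /=; rewrite sat_rename e.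
Qed.

Lemma definable0 n : definable (set0 : set (n.-tuple S)).
Proof. by exists 0, [tuple], (FFalse _ _). Qed.

(** The two parameter tuples are concatenated; [r1] and [r2] lead each formula to its own block. *)
Lemma definable_imp n (A B : set (n.-tuple S)) :
  definable A -> definable B -> definable [set v | A v -> B v].
Proof.
case=> k [b [phi ->]] [l [c [psi ->]]]; exists (k + l), (cat_tuple b c).
pose r1 (i : 'I_(n + k)) : 'I_(n + (k + l)) :=
  match fintype.split i with inl j => lshift _ j | inr j => rshift n (lshift l j) end.
pose r2 (i : 'I_(n + l)) : 'I_(n + (k + l)) :=
  match fintype.split i with inl j => lshift _ j | inr j => rshift n (rshift k j) end.
exists (FImp (rename phi r1) (rename psi r2)).
have e1 v : reindex r1 (cat_tuple v (cat_tuple b c)) = cat_tuple v b.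
  apply: eq_from_tnth => i; rewrite tnth_mktuple -(fintype.splitK i) /r1.
  by case: (fintype.split i) => j; rewrite unsplitK /= ?(tnth_lshift, tnth_rshift).
have e2 v : reindex r2 (cat_tuple v (cat_tuple b c)) = cat_tuple v c.
  apply: eq_from_tnth => i; rewrite tnth_mktuple -(fintype.splitK i) /r2.
  by case: (fintype.split i) => j; rewrite unsplitK /= ?(tnth_lshift, tnth_rshift).
by apply/seteqP; split=> v /=; rewrite !sat_rename e1 e2.
Qed.

Lemma definable_forall n (A : set (n.+1.-tuple S)) :
  definable A -> definable [set v | forall a, A (cons_tuple a v)].
Proof.
(* The scopes [n.+1 + k] and [(n + k).+1] are convertible, so [phi] can be quantified as it
   stands. *)
case=> k [b [phi ->]]; exists k, b, (@FForall L (n + k) phi).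
have e a (v : n.-tuple S) :
    cons_tuple a (cat_tuple v b) = cat_tuple (cons_tuple a v) b by apply: val_inj.
by apply/seteqP; split=> v /= H a; [rewrite e|rewrite -e].
Qed.

Lemma definableC n (A : set (n.-tuple S)) : definable A -> definable (~` A).
Proof. by move=> dA; exact: definable_imp dA (definable0 n). Qed.

Lemma definableU n (A B : set (n.-tuple S)) :
  definable A -> definable B -> definable (A `|` B).
Proof.
move=> /definableC dA dB; have := definable_imp dA dB; congr definable.
apply/seteqP; split=> v /=; last by case.
by move=> H; have [|/H] := pselect (A v); [left|right].
Qed.

Lemma definableI n (A B : set (n.-tuple S)) :
  definable A -> definable B -> definable (A `&` B).
Proof.
move=> /definableC dA /definableC dB; rewrite -[_ `&` _]setCK setCI.
exact/definableC/definableU.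
Qed.

Lemma definableD n (A B : set (n.-tuple S)) :
  definable A -> definable B -> definable (A `\` B).
Proof. by move=> dA /definableC; rewrite setDE; exact: definableI. Qed.

Lemma definable_bigcup n (I : finType) (P : set I) (F : I -> set (n.-tuple S)) :
  (forall i, P i -> definable (F i)) -> definable (\bigcup_(i in P) F i).
Proof.
move=> dF; rewrite bigcup_mkcond.
have -> : \bigcup_i (if i \in P then F i else set0)
        = \big[setU/set0]_i (if i \in P then F i else set0).
  rewrite -bigcup_seq; apply: eq_bigcupl; split=> i _ //=.
  by rewrite mem_index_enum.
elim/big_ind: _ => [|A B dA dB|i _]; [exact: definable0|exact: definableU|].
by case: ifPn => [/set_mem/dF//|_]; exact: definable0.
Qed.

Lemma definable_exists n (A : set (n.+1.-tuple S)) :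
  definable A -> definable [set v | exists a, A (cons_tuple a v)].
Proof.
move=> /definableC/definable_forall/definableC; congr definable.
apply/seteqP; split=> v /=; last by move=> [a Aa] /(_ a).
by move=> /existsNP[a /contrapT Aa]; exists a.
Qed.

Lemma definable_proj n m (A : set ((n + m).-tuple S)) :
  definable A -> definable [set v | exists u : n.-tuple S, A (cat_tuple u v)].
Proof.
elim: n A => [|n IH] A dA.
  suff -> : [set v | exists u : 0.-tuple S, A (cat_tuple u v)] = A by [].
  apply/seteqP; split=> v /=.
    by move=> [u]; congr A; apply: val_inj; rewrite /= (tuple0 u).
  by move=> Av; exists [tuple]; move: Av; congr A; apply: val_inj.
have := IH _ (definable_exists (dA : definable (A : set ((n + m).+1.-tuple S)))).
congr definable; apply/seteqP; split=> v /=.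
  move=> [u [a Au]]; exists (cons_tuple a u).
  by move: Au; congr A; apply: val_inj.
move=> [u Au]; exists (behead_tuple u), (thead u).
move: Au; congr A; apply: val_inj => /=; case: u => -[|a u] //= s.
Qed.

(** The image is the projection of the graph of [f] cut down to the cylinder over [A]. *)
Lemma definable_image n (f : n.-tuple S -> n.-tuple S) (A : set (n.-tuple S)) :
  definable (function_graph f) -> definable A -> definable (f @` A).
Proof.
move=> df /(definable_reindex (@lshift n n)) dA.
have := definable_proj (definableI dA df); congr definable.
have e (u v : n.-tuple S) : reindex (@lshift n n) (cat_tuple u v) = u.
  by apply: eq_from_tnth => i; rewrite tnth_mktuple tnth_lshift.
have e' (u v : n.-tuple S) : reindex (@rshift n n) (cat_tuple u v) = v.
  by apply: eq_from_tnth => i; rewrite tnth_mktuple tnth_rshift.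
apply/seteqP; split=> v /=.
  move=> [u [+ [w _ wu]]]; rewrite e => Au; exists u => //.
  by rewrite -[LHS](e' w) -[RHS](e' u) -wu; congr (reindex _ (cat_tuple _ (f _))); rewrite -(e u v) -wu e.
by move=> [u Au <-]; exists u; rewrite e; split=> //; exists u.
Qed.
End Definability.

(** * States on ordered groups *)

Local Open Scope ring_scope.

Section States.
Variables (G : zmodType) (e : G).
Implicit Types (C : set G) (g h : G).

(** The nonnegative elements of a translation-invariant preorder on [G] in which [e] is strictly
    positive. *)
Definition proper_cone C :=
  [/\ C 0, forall g h, C g -> C h -> C (g + h), C e & ~ C (- e)].

Lemma proper_coneMn C g k : proper_cone C -> C g -> C (g *+ k).
Proof.
case=> C0 CD _ _ Cg; elim: k => [|k IH]; first by rewrite mulr0n.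
by rewrite mulrS; exact: CD.
Qed.

Lemma proper_coneN_Mn C k : proper_cone C -> ~ C (- (e *+ k.+1)).
Proof.
move=> pC; case: (pC) => C0 CD Ce; apply: contra_not => Ck.
have -> : - e = - (e *+ k.+1) + e *+ k by rewrite mulrS opprD addrNK.
by apply: CD => //; exact: proper_coneMn.
Qed.

Lemma proper_coneMz C (z : int) : proper_cone C -> C (e *~ z) -> 0 <= z.
Proof. by move=> pC; case: z => // k; rewrite NegzE => /proper_coneN_Mn-/(_ pC). Qed.

(** In a maximal cone, if neither [g] nor [- g] could be adjoined, [- e] would have the forms
    [c + g *+ k] and [d - g *+ l]. Eliminating [g] puts a negative multiple of [e] in the cone. *)
Lemma total_extension P : proper_cone P ->
  exists C, [/\ proper_cone C, P `<=` C & forall g, C g \/ C (- g)].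
Proof.
move=> pP; pose Q C := C = set0 \/ proper_cone C /\ P `<=` C.
have [F FQ tF|M [QM maxM]] := @Zorn_bigcup G Q.
  have [[C [FC C0]]|noC] := pselect (exists C, F C /\ C !=set0); last first.
    left; apply/seteqP; split=> // g [C FC Cg]; apply: noC.
    by exists C; split=> //; exists g.
  right; have QC B : F B -> B !=set0 -> proper_cone B /\ P `<=` B.
    by move=> FB /set0P/eqP B0; case: (FQ _ FB).
  have [[C00 CD Ce CN] PC] := QC _ FC C0.
  split; last by move=> g Pg; exists C => //; exact: PC.
  split; [by exists C| |by exists C|].
    move=> g h [A FA Ag] [B FB Bh].
    have [AB|BA] := tF _ _ FA FB.
      have [[_ BD _ _] _] := QC B FB (ex_intro _ _ Bh).
      by exists B => //; apply: BD => //; exact: AB.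
    have [[_ AD _ _] _] := QC A FA (ex_intro _ _ Ag).
    by exists A => //; apply: AD => //; exact: BA.
  move=> [A FA Ae]; have [[_ _ _]] := QC A FA (ex_intro _ _ Ae).
  by move=> /(_ Ae).
have [M0|[pM PM]] := QM.
  exfalso; apply: (maxM P); last by (right; split).
  rewrite M0 properEneq; split=> //; apply/eqP => P0.
  by have [] := pP; rewrite -P0.
exists M; split=> //.
have [M0 MD Me MN] := pM.
(* Adjoining the multiples of [g] gives a strictly larger set closed under addition; by maximality
   it fails to be proper, so it contains [- e]. *)
have ext g : ~ M g -> exists k c, M c /\ - e = c + g *+ k.
  move=> Mg; pose B := [set h | exists c k, M c /\ h = c + g *+ k].
  have MB : M `<=` B by move=> h Mh; exists h, 0%N; rewrite mulr0n addr0.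
  have : ~ Q B.
    apply: maxM; rewrite properEneq; split=> //; apply/eqP => E; apply: Mg.
    by rewrite E; exists 0, 1%N; rewrite add0r.
  move=> nQB; apply: contrapT => nB; apply: nQB; right; split; last first.
    exact: subset_trans MB.
  split; [exact: MB| |exact: MB|].
    move=> h h' [c [k [Mc ->]]] [c' [k' [Mc' ->]]]; exists (c + c'), (k + k')%N.
    by split; [exact: MD|rewrite mulrnDr addrACA].
  by move=> [c [k [Mc E]]]; apply: nB; exists k, c.
move=> g; have [|/ext[k [c [Mc ck]]]] := pselect (M g); first by left.
have [|/ext[l [d [Md dl]]]] := pselect (M (- g)); first by right.
exfalso; case: k ck => [|k] ck.
  by apply: MN; rewrite ck mulr0n addr0.
apply: (@proper_coneN_Mn M (l + k) pM).
have -> : - (e *+ (l + k).+1) = c *+ l + d *+ k.+1.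
  rewrite -addnS mulrnDr opprD -!mulNrn {1}ck dl !mulrnDl -!mulrnA addrACA.
  by rewrite mulNrn [(k.+1 * l)%N]mulnC subrr addr0.
by apply: MD; exact: proper_coneMn.
Qed.

(** The unit [e] need not bound all of [G]; the state is studied on the elements between two
    multiples of [e]. *)
Definition order_bounded C g :=
  exists k : nat, C (e *+ k - g) /\ C (e *+ k + g).

(** * The state of a total cone *)

Section Value.
Variables (R : realType) (C : set G).
Hypotheses (pC : proper_cone C) (totC : forall g, C g \/ C (- g)).

(** The lower Dedekind cut of [g], measured in units of [e]. *)
Definition lower_ratios g : set R :=
  [set x | exists (p : int) (q : nat),
     [/\ (0 < q)%N, x = p%:~R / q%:R & C (g *+ q - e *~ p)]].

Definition state g : R := sup (lower_ratios g).

Let CD g h : C g -> C h -> C (g + h). Proof. by case: pC => _ H _ _; exact: H. Qed.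

(** If [e *~ p] is below [g *+ q] and [g] is below [e *+ k], then [e *~ p] is below [e *+ (k * q)],
    which forces [p <= k * q]. *)
Lemma lower_ratios_ub g (k : nat) : C (e *+ k - g) -> ubound (lower_ratios g) k%:R.
Proof.
move=> Cg x [p [q [q0 -> Cp]]]; rewrite ler_pdivrMr ?ltr0n//.
have /proper_coneMz-/(_ pC) : C (e *~ ((k * q)%:Z - p)).
  rewrite mulrzBr -(subrK (g *+ q) (e *~ _)) -addrA.
  apply: CD => //; rewrite -pmulrn mulrnA -mulrnBl.
  exact: proper_coneMn.
by rewrite subr_ge0 -(ler_int R) -natrM.
Qed.

Lemma has_sup_lower_ratios g : order_bounded C g -> has_sup (lower_ratios g).
Proof.
move=> [k [Ck Ck']]; split; last by exists k%:R; exact: lower_ratios_ub.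
exists (- k%:R), (- k%:Z), 1%N; split=> //.
  by rewrite divr1 intrN.
by rewrite mulr1n mulrNz opprK addrC.
Qed.

Lemma order_bounded0 : order_bounded C 0.
Proof. by exists 0%N; rewrite subr0 addr0 mulr0n; case: pC. Qed.

Lemma order_boundedN g : order_bounded C g -> order_bounded C (- g).
Proof. by move=> [k [? ?]]; exists k; rewrite opprK. Qed.

Lemma order_boundedD g h :
  order_bounded C g -> order_bounded C h -> order_bounded C (g + h).
Proof.
move=> [k [k1 k2]] [l [l1 l2]]; exists (k + l)%N.
by rewrite mulrnDr opprD; split; rewrite addrACA; exact: CD.
Qed.

Lemma state_ge0 g : order_bounded C g -> C g -> 0 <= state g.
Proof.
move=> bg Cg; apply: ub_le_sup; first by case: (has_sup_lower_ratios bg).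
by exists 0, 1%N; rewrite mul0r mulr0z subr0.
Qed.

Lemma state_unit : state e = 1.
Proof.
apply/eqP; rewrite eq_le; apply/andP; split.
  apply: ge_sup; last by apply: (@lower_ratios_ub e 1); rewrite subrr; case: pC.
  by exists 1, 1, 1%N; rewrite divr1 subrr; case: pC.
apply: ub_le_sup.
  by exists 1; apply: (@lower_ratios_ub e 1); rewrite subrr; case: pC.
by exists 1, 1%N; rewrite divr1 subrr; case: pC.
Qed.

(** Over a common denominator, lower fractions of [g] and [h] add up to a lower fraction of
    [g + h]. *)
Lemma state_superadditive g h : order_bounded C g -> order_bounded C h ->
  state g + state h <= state (g + h).
Proof.
move=> bg bh; rewrite -sup_sumE; try exact: has_sup_lower_ratios.
apply: ge_sup.
  case: (has_sup_lower_ratios bg) (has_sup_lower_ratios bh) => [[x Hx] _] [[y Hy] _].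
  by exists (x + y), x => //; exists y.
move=> _ [_ [p [q [q0 -> Cp]]] [_ [p' [q' [q0' -> Cp']]] <-]].
apply: ub_le_sup; first by case: (has_sup_lower_ratios (order_boundedD bg bh)).
exists (p * q' + p' * q), (q * q')%N; split; first by rewrite muln_gt0 q0.
  rewrite intrD !intrM natrM; field.
  by rewrite !pnatr_eq0 -!lt0n q0 q0'.
have -> : (g + h) *+ (q * q') - e *~ (p * q' + p' * q) =
  (g *+ q - e *~ p) *+ q' + (h *+ q' - e *~ p') *+ q.
  have ez (z : int) (k : nat) : e *~ (z * k) = e *~ z *+ k by rewrite mulrzA pmulrn.
  rewrite mulrnDl mulrzDr !ez !mulrnBl -!(mulrnA g, mulrnA h) [(q' * q)%N]mulnC.
  by rewrite opprD addrACA.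
by apply: CD; exact: proper_coneMn.
Qed.

Lemma state0 : state 0 = 0.
Proof.
apply/eqP; rewrite eq_le; apply/andP; split.
  apply: ge_sup; last by apply: (@lower_ratios_ub 0 0); rewrite mulr0n subrr; case: pC.
  by case: (has_sup_lower_ratios order_bounded0).
by apply: state_ge0; [exact: order_bounded0|case: pC].
Qed.

(** One inequality is superadditivity. For the other, totality of the cone decides on which side of
    [g] a rational in the gap between [state g] and [- state (- g)] lies, and either answer
    contradicts a supremum. *)
Lemma stateN g : order_bounded C g -> state (- g) = - state g.
Proof.
move=> bg; apply/eqP; rewrite eq_le; apply/andP; split.
  have := state_superadditive bg (order_boundedN bg).
  by rewrite subrr state0 addrC -lerBrDr sub0r.
rewrite lerNl; apply/ler_addgt0Pl => d d0.
rewrite -lerBlDl; rewrite leNgt; apply/negP => /rat_in_itvoo[r].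
rewrite in_itv /= => /andP[lt1 lt2].
have rE : ratr r = (numq r)%:~R / `|denq r|%:R :> R.
  by rewrite /ratr [in RHS]natr_absz ger0_norm// denq_ge0.
have q0 : (0 < `|denq r|)%N by rewrite absz_gt0 denq_neq0.
have [Cr|Cr] := totC (g *+ `|denq r| - e *~ numq r).
  have : ratr r <= state g.
    apply: ub_le_sup; first by case: (has_sup_lower_ratios bg).
    by exists (numq r), `|denq r|%N.
  lra.
have : - ratr r <= state (- g).
  apply: ub_le_sup; first by case: (has_sup_lower_ratios (order_boundedN bg)).
  exists (- numq r), `|denq r|%N; split=> //; first by rewrite rE intrN mulNr.
  by rewrite mulrNz opprK mulNrn addrC -opprB.
lra.
Qed.

(** Superadditivity at [- g] and [- h] is subadditivity at [g] and [h]. *)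
Lemma stateD g h : order_bounded C g -> order_bounded C h ->
  state (g + h) = state g + state h.
Proof.
move=> bg bh; apply/eqP; rewrite eq_le state_superadditive// andbT.
have := state_superadditive (order_boundedN bg) (order_boundedN bh).
rewrite -opprD !stateN//; last exact: order_boundedD.
by rewrite -opprD lerN2.
Qed.
End Value.
End States.

(** * Multiplicities and domination *)

Section Multiplicity.
Local Open Scope nat_scope.
Variable T : Type.
Implicit Types I J : finType.

Definition ind (A : set T) (x : T) : nat := `[< A x >].

(** The number of summands containing [x]: the counting function of the formal disjoint union. *)
Definition mult I (A : I -> set T) (x : T) : nat := \sum_i ind (A i) x.

Lemma ind_leP (A : set T) x m : (A x -> 0 < m) -> ind A x <= m.
Proof. by rewrite /ind; case: asboolP => // Ax; exact. Qed.

Lemma ind1 (A : set T) x : A x -> ind A x = 1.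
Proof. by move=> Ax; rewrite /ind asboolT. Qed.

Lemma ind0 (A : set T) x : ~ A x -> ind A x = 0.
Proof. by move=> Ax; rewrite /ind asboolF. Qed.

Lemma indS (A B : set T) x : A `<=` B -> ind A x <= ind B x.
Proof. by move=> AB; apply: ind_leP => /AB Bx; rewrite ind1. Qed.

Lemma indU (A B : set T) x : A `&` B = set0 -> ind (A `|` B) x = ind A x + ind B x.
Proof.
move=> AB; have [Ax|nAx] := pselect (A x).
  rewrite (ind1 Ax) ind1; last by left.
  by rewrite ind0// => Bx; have : (A `&` B) x by []; rewrite AB.
rewrite [ind A x]ind0// add0n /ind; congr (nat_of_bool _).
by apply: asbool_equiv_eq; split=> [[]//|]; right.
Qed.

Lemma mult_ge1 I (A : I -> set T) i x : A i x -> 0 < mult A x.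
Proof. by move=> Ai; rewrite /mult (bigD1 i)//= ind1. Qed.

Lemma mult_le_ind I (A : I -> set T) (B : set T) x :
  (forall i j, A i x -> A j x -> i = j) -> (forall i, A i x -> B x) ->
  mult A x <= ind B x.
Proof.
move=> inj AB; have [[i Ai]|no] := pselect (exists i, A i x); last first.
  by rewrite /mult big1// => i _; rewrite ind0// => Ai; apply: no; exists i.
rewrite /mult (bigD1 i)//= big1 ?addn0 ?ind1//; first exact: AB Ai.
by move=> j /eqP ji; rewrite ind0// => Aj; apply: ji; exact: inj.
Qed.

Lemma mult_prod I J (A : I * J -> set T) x :
  mult A x = \sum_i mult (fun j => A (i, j)) x.
Proof. by rewrite /mult pair_big; apply: eq_bigr => -[]. Qed.

Lemma mult_prod' I J (A : I * J -> set T) x :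
  mult A x = \sum_j mult (fun i => A (i, j)) x.
Proof. by rewrite mult_prod /mult exchange_big. Qed.

Lemma mult_sum I J (A : I + J -> set T) x :
  mult A x = mult (fun i => A (inl i)) x + mult (fun j => A (inr j)) x.
Proof. by rewrite /mult big_sumType. Qed.

Lemma mult_unit (A : unit -> set T) x : mult A x = ind (A tt) x.
Proof. by rewrite /mult (bigD1 tt)//= big1 ?addn0// => -[]. Qed.

Lemma mult_const I (A : set T) x : mult (fun _ : I => A) x = #|I| * ind A x.
Proof. by rewrite /mult sum_nat_const. Qed.

(** This set of indices names the atom, in the finite Boolean algebra generated by the family, to
    which [x] belongs. *)
Definition members I (A : I -> set T) (x : T) : {set I} := [set i | `[< A i x >]]%SET.

Lemma in_members I (A : I -> set T) x i : (i \in members A x) <-> A i x.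
Proof. by rewrite inE; split=> /asboolP. Qed.

Lemma mult_card I (A : I -> set T) x : mult A x = #|members A x|.
Proof. by rewrite -sum1dep_card big_mkcond; apply: eq_bigr => i _; rewrite /ind; case: asboolP. Qed.
End Multiplicity.

(** * Domination of counting functions by piecewise isomorphisms *)

Section Domination.
Local Open Scope nat_scope.
Variables (L : signature) (S : structure L) (Iso : isomorphisms S) (n : nat).
Local Notation T := (n.-tuple S).
Implicit Types I J K : finType.

Lemma definable_members I (A : I -> set T) (s : {set I}) :
  (forall i, definable (A i)) -> definable [set x | members A x = s].
Proof.
move=> dA; have -> : [set x | members A x = s] =
    ~` \bigcup_(i in [set: I]) (if i \in s then ~` A i else A i).
  apply/seteqP; split=> x /=.
    move=> <- [i _]; case: ifPn => [/in_members Ai /(_ Ai)//|].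
    by move=> /negP + Ai; apply; apply/in_members.
  move=> nx; apply/setP => i; apply/idP/idP => [/in_members Ai|si].
    by apply: contrapT => /negP si; apply: nx; exists i => //; rewrite (negbTE si).
  apply/in_members; apply: contrapT => nA; apply: nx; exists i => //.
  by rewrite si.
apply/definableC/definable_bigcup => i _.
by case: ifP => // _; exact: definableC.
Qed.

(* At a point x, the k-th index i with [A i x] is matched with the k-th index j
   with [B j x]. *)
Lemma refinement I J (A : I -> set T) (B : J -> set T) :
  (forall i, definable (A i)) -> (forall j, definable (B j)) ->
  (forall x, mult A x <= mult B x) ->
  exists Q : I -> J -> set T,
    [/\ forall i j, definable (Q i j),
        forall i j x, Q i j x -> A i x /\ B j x,
        forall i x, A i x -> exists j, Q i j x,
        forall i j j' x, Q i j x -> Q i j' x -> j = j' &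
        forall i i' j x, Q i j x -> Q i' j x -> i = i'].
Proof.
move=> dA dB AB.
pose matched i j (s : {set I}) (t : {set J}) :=
  [&& i \in s, j \in t & index i (enum s) == index j (enum t)].
exists (fun i j => [set x | matched i j (members A x) (members B x)]).
split.
(* The matching depends on the two atoms of [x] only, so [Q i j] is a finite union of intersections
   of atoms. *)
- move=> i j; have -> : [set x | matched i j (members A x) (members B x)] =
    \bigcup_(p in [set p : {set I} * {set J} | matched i j p.1 p.2])
       ([set x | members A x = p.1] `&` [set x | members B x = p.2]).
    apply/seteqP; split=> x /=; last by move=> [p ? [-> ->]].
    by move=> ?; exists (members A x, members B x).
  by apply: definable_bigcup => p _; apply: definableI; exact: definable_members.
- by move=> i j x /= /and3P[/in_members ? /in_members].
- move=> i x Ai.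
  have iA : i \in members A x by apply/in_members.
  (* As [mult A x <= mult B x], the rank of [i] is a valid rank among the indices [j] with
     [B j x]. *)
  have lt : index i (enum (members A x)) < size (enum (members B x)).
    rewrite -cardE; apply: leq_trans (_ : mult A x <= _).
      by rewrite mult_card cardE index_mem mem_enum.
    by rewrite -mult_card.
  have /card_gt0P[j0 _] : 0 < #|members B x| by rewrite cardE; exact: leq_ltn_trans lt.
  exists (nth j0 (enum (members B x)) (index i (enum (members A x)))).
  rewrite /= /matched iA -mem_enum mem_nth//= index_uniq//; exact: enum_uniq.
- move=> i j j' x /and3P[_ jB /eqP e] /and3P[_ j'B /eqP]; rewrite e.
  by apply: (index_inj j); rewrite mem_enum.
- move=> i i' j x /and3P[iA _ /eqP e] /and3P[i'A _ /eqP]; rewrite -e => /esym.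
  by apply: (index_inj i); rewrite mem_enum.
Qed.

Lemma iso_inverse (f : T -> T) : Iso n f ->
  exists g, [/\ Iso n g, cancel f g & cancel g f].
Proof.
move=> If; have [g fg gf] := iso_bijective If.
by exists g; split=> //; exact: iso_inv If fg gf.
Qed.

Lemma iso_injective (f : T -> T) : Iso n f -> injective f.
Proof. by move=> /iso_inverse[g [_ fg _]]; exact: can_inj fg. Qed.

(** The identity is not a field of [isomorphisms]; it is obtained by composing any isomorphism with
    its inverse. *)
Lemma iso_id (f : T -> T) : Iso n f -> Iso n id.
Proof.
move=> If; have [g [Ig fg _]] := iso_inverse If.
by rewrite -(_ : g \o f = id); [exact: iso_comp|apply/funext => x; exact: fg].
Qed.

Lemma iso_image_definable (f : T -> T) (A : set T) :
  Iso n f -> definable A -> definable (f @` A).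
Proof. by move=> /iso_definable; exact: definable_image. Qed.

Lemma iso_preimage_definable (f : T -> T) (A : set T) :
  Iso n f -> definable A -> definable (f @^-1` A).
Proof.
move=> If; have [g [Ig fg gf]] := iso_inverse If.
suff -> : f @^-1` A = g @` A by exact: iso_image_definable.
apply/seteqP; split=> x /=; first by exists (f x).
by move=> [y Ay <-]; rewrite gf.
Qed.

Lemma iso_image_preimage (f : T -> T) (A : set T) :
  Iso n f -> f @` (f @^-1` A) = A.
Proof.
move=> If; have [g [_ _ gf]] := iso_inverse If.
by apply/seteqP; split=> [_ [x ? <-]//|x Ax]; exists (g x); rewrite /= gf.
Qed.

Lemma iso_imageP (f : T -> T) (A : set T) x : Iso n f -> (f @` A) (f x) -> A x.
Proof. by move=> If [y Ay /(iso_injective If) <-]. Qed.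

(* The analogue of [embeds] for functions to nat; stating it with
   inequalities only avoids choosing a partition. *)
Definition dominated (g h : T -> nat) := exists K (P : K -> set T) (f : K -> T -> T),
  [/\ forall a, definable (P a), forall a, Iso n (f a),
      forall x, g x <= mult P x & forall x, mult (fun a => f a @` P a) x <= h x].

Lemma dominated_mono (g g' h h' : T -> nat) :
  (forall x, g' x <= g x) -> (forall x, h x <= h' x) ->
  dominated g h -> dominated g' h'.
Proof.
move=> gg hh [K [P [f [dP If gP Ph]]]]; exists K, P, f; split=> // x.
  exact: leq_trans (gg x) (gP x).
exact: leq_trans (Ph x) (hh x).
Qed.

Lemma dominated0 (h : T -> nat) : dominated (fun=> 0) h.
Proof. by exists void, (fun=> set0), (fun=> id); split=> [[]|[]|//|x]; rewrite /mult big1// => -[]. Qed.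

Lemma dominatedD (g g' h h' : T -> nat) : dominated g h -> dominated g' h' ->
  dominated (fun x => g x + g' x) (fun x => h x + h' x).
Proof.
move=> [K [P [f [dP If gP Ph]]]] [K' [P' [f' [dP' If' gP' Ph']]]].
exists (K + K')%type, (fun a => match a with inl a => P a | inr a => P' a end),
  (fun a => match a with inl a => f a | inr a => f' a end).
by split=> [[]|[]|x|x] //; rewrite mult_sum; exact: leq_add.
Qed.

Lemma dominated_sum I (g h : I -> T -> nat) : (forall i, dominated (g i) (h i)) ->
  dominated (fun x => \sum_i g i x) (fun x => \sum_i h i x).
Proof.
move=> gh; elim: (index_enum I) => [|i s IH].
  by apply: dominated_mono (dominated0 (fun=> 0)) => x; rewrite big_nil.
by apply: dominated_mono (dominatedD (gh i) IH) => x; rewrite big_cons.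
Qed.

(** [W a b] is the part of the image of [P a] under [f a] that is matched with [Q b]. Its preimage
    is moved by [u b \o f a]; for fixed [b] the resulting images are disjoint inside the image of
    [Q b]. *)
Lemma dominated_trans (g h k : T -> nat) :
  dominated g h -> dominated h k -> dominated g k.
Proof.
move=> [K [P [f [dP If gP Ph]]]] [M [Q [u [dQ Iu hQ Qk]]]].
have [||W [dW WPQ PW _ Winj]] := @refinement _ _ (fun a => f a @` P a) Q _ dQ.
- by move=> a; exact: iso_image_definable.
- by move=> x; exact: leq_trans (Ph x) (hQ x).
exists (K * M)%type, (fun ab => f ab.1 @^-1` W ab.1 ab.2),
  (fun ab => u ab.2 \o f ab.1); split=> [ab|ab|x|x].
- exact: iso_preimage_definable.
- exact: iso_comp.
- apply: leq_trans (gP x) _; rewrite mult_prod; apply: leq_sum => a _.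
  apply: ind_leP => Pa; have [|b Wab] := PW a (f a x); first by exists x.
  exact: mult_ge1 Wab.
- apply: leq_trans (Qk x); rewrite mult_prod'; apply: leq_sum => b _.
  under [fun a => _]funext => a do rewrite -image_comp iso_image_preimage//=.
  apply: mult_le_ind => [a a' [y Wy <-] [z Wz /(iso_injective (Iu b)) zy]|a].
    by apply: Winj Wy _; rewrite -zy.
  by move=> [y /WPQ[_ Qy] <-]; exists y.
Qed.

Lemma dominated_image K (P : K -> set T) (f : K -> T -> T) :
  (forall a, definable (P a)) -> (forall a, Iso n (f a)) ->
  dominated (mult P) (mult (fun a => f a @` P a)).
Proof. by move=> dP If; exists K, P, f. Qed.

Lemma inverse_moves K (P : K -> set T) (f : K -> T -> T) :
  (forall a, Iso n (f a)) -> exists g : K -> T -> T,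
  (forall a, Iso n (g a)) /\ (fun a => g a @` (f a @` P a)) = P.
Proof.
move=> If; have /choice[g Hg] a := iso_inverse (If a).
exists g; split=> [a|]; first by case: (Hg a).
apply/funext => a; rewrite image_comp; have [_ fg _] := Hg a.
by rewrite (_ : _ \o _ = id) ?image_id//; apply/funext => x; exact: fg.
Qed.

Lemma dominated_image1 (A : set T) (f : T -> T) :
  definable A -> Iso n f -> dominated (ind A) (ind (f @` A)).
Proof.
move=> dA If; exists unit, (fun=> A), (fun=> f).
by split=> // x; rewrite mult_unit.
Qed.

Lemma dominated_refl K (P : K -> set T) (f : T -> T) : Iso n f ->
  (forall a, definable (P a)) -> dominated (mult P) (mult P).
Proof.
move=> /iso_id Iid dP; have := dominated_image dP (fun=> Iid).
by congr dominated; apply/funext => x; congr mult; apply/funext => a; exact: image_id.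
Qed.

(** A cutting numbers its pieces by an ordinal, whereas refinements are indexed by products;
    [enum_val] translates between the two. *)
Lemma cutting_of_finType I J (A : I -> set T) K (P : K -> set T)
    (src : K -> I) (tgt : K -> J) (f : K -> T -> T) :
  (forall a, definable (P a)) -> (forall a, Iso n (f a)) ->
  (forall a b x, src a = src b -> P a x -> P b x -> a = b) ->
  (forall i, \bigcup_(a in [set a | src a = i]) P a = A i) ->
  (forall a b x, tgt a = tgt b -> (f a @` P a) x -> (f b @` P b) x -> a = b) ->
  exists c : cutting Iso J A, forall j,
    cutting_image c j = \bigcup_(a in [set a | tgt a = j]) (f a @` P a).
Proof.
move=> dP If Pd PA fd.
have reidx (D : set K) (F : K -> set T) :
    \bigcup_(k in [set k : 'I_#|K| | D (enum_val k)]) F (enum_val k) =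
    \bigcup_(a in D) F a.
  apply/seteqP; split=> [x [k Dk Fx]|x [a Da Fx]]; first by exists (enum_val k).
  by exists (enum_rank a); rewrite /= enum_rankK.
unshelve eexists.
  exists #|K| (P \o enum_val) (src \o enum_val) (tgt \o enum_val) (f \o enum_val).
  - by move=> a; exact: dP.
  - by move=> a; exact: If.
  - move=> i a b /= <- ab [x [Pa Pb]].
    by apply: enum_val_inj; apply: Pd Pa Pb; rewrite ab.
  - by move=> i; rewrite -PA -(reidx _ P).
  - move=> j a b /= <- ab [x [Pa Pb]].
    by apply: enum_val_inj; apply: fd Pa Pb; rewrite ab.
by move=> j; rewrite /cutting_image /= -(reidx _ (fun a => f a @` P a)).
Qed.

(** Two refinements rebuild a genuine partition: the first distributes the summands of [A] among the
    pieces [P a], the second distributes the moved parts among the summands of [B]. The piece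
    [(i, a, j)] goes from summand [i] to summand [j] by [f a]. *)
Lemma embeds_of_dominated I J (A : I -> set T) (B : J -> set T) :
  (forall i, definable (A i)) -> (forall j, definable (B j)) ->
  dominated (mult A) (mult B) -> embeds Iso A B.
Proof.
move=> dA dB [K [P [f [dP If AP PB]]]].
have [V [dV VAP AV Vinj Vinj']] := refinement dA dP AP.
have [|x|W [dW WVB VW Winj Winj']] :=
  @refinement _ _ (fun ia : I * K => f ia.2 @` V ia.1 ia.2) B _ dB.
- by move=> ia; exact: iso_image_definable.
- apply: leq_trans (PB x); rewrite mult_prod'; apply: leq_sum => a _.
  apply: mult_le_ind => [i i'|i] /=.
    by move=> [y Vy <-] [z Vz /(iso_injective (If a)) zy]; apply: Vinj' Vy _; rewrite -zy.
  by move=> [y /VAP[_ Py] <-]; exists y.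
have [|||||c cE] := @cutting_of_finType I J A (I * K * J)%type
  (fun k => f k.1.2 @^-1` W k.1 k.2) (fun k => k.1.1) snd (fun k => f k.1.2).
- by move=> k; exact: iso_preimage_definable.
- by [].
- move=> [[i a] j] [[i' a'] j'] x /= <- Wx Wx'.
  have aa' : a = a'.
    have [/(iso_imageP (If a))/= Vx _] := WVB _ _ _ Wx.
    have [/(iso_imageP (If a'))/= Vx' _] := WVB _ _ _ Wx'.
    exact: Vinj Vx Vx'.
  by rewrite -aa' in Wx' *; congr (_, _); exact: Winj Wx Wx'.
- move=> i; apply/seteqP; split=> [x [[[i' a] j] /= <- /WVB[]]|x /AV[a Vx]].
    by move=> /(iso_imageP (If a))/= /VAP[].
  have [|j Wx] := VW (i, a) (f a x); first by exists x.
  by exists (i, a, j).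
- move=> k k'; case: k k' => [k j] [k' j'] x tt'; rewrite !iso_image_preimage//.
  rewrite /= in tt' *; rewrite -tt' => Wx Wx'.
  by congr (_, _); exact: Winj' Wx Wx'.
exists c => j; rewrite cE => x [[k j'] ->].
by rewrite iso_image_preimage// => /WVB[].
Qed.

Lemma embeds_empty I J (A : I -> set T) (B : J -> set T) :
  (forall i, A i = set0) -> (forall j, definable (B j)) -> embeds Iso A B.
Proof.
move=> A0 dB; apply: embeds_of_dominated => // [i|].
  by rewrite A0; exact: definable0.
apply: dominated_mono (dominated0 _) => // x.
by rewrite /mult big1// => i _; rewrite A0 ind0.
Qed.
End Domination.

(** * Construction of the measure *)

Section Gains.
Variables (L : signature) (S : structure L) (Iso : isomorphisms S) (n : nat).
Local Notation T := (n.-tuple S).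
Implicit Types (K : finType) (A B : set T).
Variables (X : set T) (hX : definable X) (Iid : Iso n id).

(** These sets form the ideal on which the constructed measure is finite. *)
Definition bounded A := definable A /\
  exists k : nat, dominated Iso (ind A) (fun x => (k * ind X x)%N).

Lemma dominated_copies (k : nat) :
  dominated Iso (fun x => (k * ind X x)%N) (fun x => (k * ind X x)%N).
Proof.
have := dominated_refl Iid (fun _ : 'I_k => hX).
by congr dominated; apply/funext => x; rewrite mult_const card_ord.
Qed.

Lemma bounded_dominated A B :
  definable A -> dominated Iso (ind A) (ind B) -> bounded B -> bounded A.
Proof.
move=> dA AB [_ [k Bk]]; split=> //; exists k; exact: dominated_trans AB Bk.
Qed.

Lemma bounded_subset A B : definable A -> A `<=` B -> bounded B -> bounded A.
Proof.
move=> dA AB [_ [k Bk]]; split=> //; exists k; apply: dominated_mono Bk => // x.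
exact: indS.
Qed.

Lemma bounded_X : bounded X.
Proof.
split=> //; exists 1%N; apply: dominated_mono (dominated_copies 1) => // x.
by rewrite mul1n.
Qed.

Lemma boundedU A B : bounded A -> bounded B -> bounded (A `|` B).
Proof.
move=> [dA [k Ak]] [dB [l Bl]]; split; first exact: definableU.
exists (k + l)%N; apply: dominated_mono (dominatedD Ak Bl) => x.
  apply: ind_leP => -[] H; rewrite (ind1 H); [exact: ltn_addr|exact: ltn_addl].
by rewrite mulnDl.
Qed.

Lemma bounded_mult K (Q : K -> set T) : (forall a, bounded (Q a)) ->
  exists k : nat, dominated Iso (mult Q) (fun x => (k * ind X x)%N).
Proof.
move=> bQ; have /choice[k Hk] a := (bQ a).2.
exists (\sum_a k a)%N; apply: dominated_mono (dominated_sum Hk) => // x.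
by rewrite big_distrl.
Qed.

(* The functions that are at least [1_(f Q) - 1_Q], summed over finitely many
   bounded definable sets Q moved by isomorphisms f. *)
Definition gains : set (T -> int) := [set g |
  exists K (Q : K -> set T) (f : K -> T -> T),
    [/\ forall a, bounded (Q a), forall a, Iso n (f a) &
        forall x, (mult (fun a => f a @` Q a) x)%:Z <= g x + (mult Q x)%:Z]].

Definition zind A : T -> int := fun x => (ind A x)%:Z.

Lemma gains_nonneg (g : T -> int) : (forall x, 0 <= g x) -> gains g.
Proof.
move=> g0; exists void, (fun=> set0), (fun=> id); split=> [[]|[]|x].
by rewrite /mult !big1 ?addr0// => -[].
Qed.

Lemma gainsD (g h : T -> int) : gains g -> gains h -> gains (g + h).
Proof.
move=> [K [Q [f [bQ If Qg]]]] [K' [Q' [f' [bQ' If' Qg']]]].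
exists (K + K')%type, (fun a => match a with inl a => Q a | inr a => Q' a end),
  (fun a => match a with inl a => f a | inr a => f' a end).
split=> [[]|[]|x] //; rewrite !mult_sum !PoszD addrfctE addrACA.
exact: lerD (Qg x) (Qg' x).
Qed.

(* If [-1_X] were a gain, then some bounded sum b of indicators would dominate
   [b + 1_X], hence [b + N 1_X] for every N. *)
Lemma proper_gains :
  ~ (exists k : nat, forall N : nat, dominated Iso
       (fun x => (N * ind X x)%N) (fun x => (k * ind X x)%N)) ->
  proper_cone (zind X) gains.
Proof.
move=> noN; split; [exact: gains_nonneg|exact: gainsD|exact: gains_nonneg|].
move=> [K [Q [f [bQ If Qg]]]]; apply: noN.
pose b := mult (fun a => f a @` Q a).
have dQ a : definable (Q a) by case: (bQ a).
have bX x : (b x + ind X x <= mult Q x)%N.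
  by have := Qg x; rewrite opprfctE /zind -/(b x); lia.
have Qb : dominated Iso (mult Q) b by exact: dominated_image.
have step N : dominated Iso (fun x => (b x + N.+1 * ind X x)%N) b.
  elim: N => [|N IH].
    by apply: dominated_mono Qb => // x; rewrite mul1n.
  (* The moves turn [mult Q], which is at least [b] plus one copy of [X], into [b]; the other [N.+1]
     copies stay in place and are absorbed by induction. *)
  have := dominated_trans (dominatedD Qb (dominated_copies N.+1)) IH.
  by apply: dominated_mono => // x; rewrite (mulSn N.+1) addnA leq_add2r.
have [k bk] := bounded_mult bQ.
(* Being below [mult Q], a finite sum of bounded sets, [b] is dominated by a multiple of [X]. *)
have {}bk : dominated Iso b (fun x => (k * ind X x)%N).
  by apply: dominated_mono bk => // x; exact: leq_trans (leq_addr _ _) (bX x).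
exists k => N; apply: dominated_mono (dominated_trans (step N) bk) => // x.
by apply: leq_trans (leq_addl _ _); rewrite leq_mul2r leqnSn orbT.
Qed.

(** The pieces that dominate [A] by [k] copies of [X] also witness that [k] times [1_X] minus [1_A]
    is a gain. Each piece is bounded because its image lies in [X]. *)
Lemma gains_bounded A : bounded A -> order_bounded (zind X) gains (zind A).
Proof.
move=> [dA [k [K [P [f [dP If AP Pk]]]]]]; exists k; split; last first.
  by apply: gains_nonneg => x; rewrite addrfctE natmulfctE /= addr_ge0// mulrn_wge0.
exists K, P, f; split=> // [a|x].
  split=> //; exists k; apply: dominated_mono (dominated_image1 (dP a) (If a)) => // x.
  by apply: leq_trans (Pk x); apply: ind_leP => fPx; exact: (@mult_ge1 _ _ (fun a => f a @` P a) a).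
have := AP x; have := Pk x.
by rewrite addrfctE opprfctE natmulfctE /= /zind pmulrn; lia.
Qed.

Section CutPieces.
Variables (K : finType) (A B : set T) (P : K -> set T) (f : K -> T -> T).
Hypothesis dA : definable A.
Hypotheses (dP : forall a, definable (P a)) (If : forall a, Iso n (f a)).
Hypotheses (AP : ind A =1 mult P) (BP : ind B =1 mult (fun a => f a @` P a)).

Lemma cut_bounded : bounded B -> bounded A.
Proof.
apply: bounded_dominated => //; apply: dominated_mono (dominated_image dP If).
  by move=> x; rewrite AP.
by move=> x; rewrite BP.
Qed.

(** The inequality required of a gain is an equality here: the pieces add up to [1_A] and their
    images to [1_B]. *)
Lemma cut_gains : bounded A -> gains (zind B - zind A).
Proof.
move=> bA; exists K, P, f; split=> // [a|x].
  apply: bounded_subset bA => // x Pa; apply: contrapT => nA.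
  by have := mult_ge1 Pa; rewrite -AP ind0.
by rewrite addrfctE opprfctE /= /zind AP BP addrNK.
Qed.
End CutPieces.

(** Each equality of counting functions combines covering, for one inequality, with disjointness,
    for the other. *)
Lemma isomorphic_pieces A B : isomorphic Iso (one_copy A) (one_copy B) ->
  exists K (P : K -> set T) (f : K -> T -> T),
    [/\ forall a, definable (P a), forall a, Iso n (f a),
        ind A =1 mult P & ind B =1 mult (fun a => f a @` P a)].
Proof.
case=> -[N P src tgt f dP If Pd PA fd] /(_ tt) cB.
exists 'I_N, P, f; split=> // x; apply/eqP; rewrite eqn_leq; apply/andP; split.
- apply: ind_leP; rewrite -[A]/(one_copy A tt) -(PA tt) => -[a _].
  exact: mult_ge1.
- apply: mult_le_ind => [a b Pa Pb|a Pa].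
    by apply: (Pd tt); rewrite /=; [case: (src a)|case: (src b)|exists x].
  by rewrite -[A]/(one_copy A tt) -(PA tt); exists a => //=; case: (src a).
- apply: ind_leP; rewrite -[B]/(one_copy B tt) -cB => -[a _ /=].
  exact: (@mult_ge1 _ _ (fun a => f a @` P a)).
- apply: mult_le_ind => [a b Pa Pb|a Pa].
    by apply: (fd tt); rewrite /=; [case: (tgt a)|case: (tgt b)|exists x].
  by rewrite -[B]/(one_copy B tt) -cB; exists a => //=; case: (tgt a).
Qed.

(** Inverting the moves exchanges [A] and [B], so one-sided statements about pieces apply in both
    directions. *)
Lemma isomorphic_bounded A B : definable A -> definable B ->
  isomorphic Iso (one_copy A) (one_copy B) ->
  (bounded A <-> bounded B) /\
  (bounded A -> gains (zind A - zind B) /\ gains (zind B - zind A)).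
Proof.
move=> dA dB /isomorphic_pieces[K [P [f [dP If AP BP]]]].
have [g [Ig gP]] := inverse_moves P If.
have dfP a : definable (f a @` P a) by exact: iso_image_definable.
have AP' : ind A =1 mult (fun a => g a @` (f a @` P a)) by rewrite gP.
have AB : bounded A -> bounded B := cut_bounded dB dfP Ig BP AP'.
split=> [|bA]; first by split=> //; exact: cut_bounded dA dP If AP BP.
by split; [exact: cut_gains dfP Ig BP AP' (AB bA)|exact: cut_gains dP If AP BP bA].
Qed.
End Gains.

(** * From states to invariant measures *)

Section Measures.
Variables (R : realType) (L : signature) (S : structure L) (Iso : isomorphisms S).
Local Open Scope ereal_scope.

(** Additivity and invariance compare sets of one dimension only, so the value 0 can be taken in all
    dimensions other than [n]. *)
Definition extend_dim n (mu : set (n.-tuple S) -> \bar R) k (A : set (k.-tuple S)) :=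
  match @eqP _ k n with
  | ReflectT e => mu (ecast i (set (i.-tuple S)) e A)
  | ReflectF _ => 0
  end.

Lemma extend_dim_same n (mu : set (n.-tuple S) -> \bar R) A :
  extend_dim mu A = mu A.
Proof. by rewrite /extend_dim; case: eqP => // e; rewrite (eq_axiomK e). Qed.

Lemma extend_dim_other n (mu : set (n.-tuple S) -> \bar R) k (A : set (k.-tuple S)) :
  k <> n -> extend_dim mu A = 0.
Proof. by rewrite /extend_dim; case: eqP. Qed.

Lemma measure_of_single_dimension n (X : set (n.-tuple S))
    (mu : set (n.-tuple S) -> \bar R) :
  (forall A, definable A -> 0 <= mu A) -> mu set0 = 0 ->
  (forall A B, definable A -> definable B -> A `&` B = set0 ->
     mu (A `|` B) = mu A + mu B) ->
  (forall A B, definable A -> definable B ->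
     isomorphic Iso (one_copy A) (one_copy B) -> mu A = mu B) ->
  mu X = 1 ->
  exists mu : forall k : nat, set (k.-tuple S) -> \bar R,
    [/\ finitely_additive mu, isom_invariant Iso mu & mu n X = 1].
Proof.
move=> mu_ge0 mu0 muU muI muX; exists (extend_dim mu).
split; last by rewrite extend_dim_same.
  split=> [k A dA|k|k A B dA dB AB].
  - have [e|ne] := pselect (k = n); last by rewrite extend_dim_other.
    by subst k; rewrite extend_dim_same; exact: mu_ge0.
  - have [e|ne] := pselect (k = n); last by rewrite extend_dim_other.
    by subst k; rewrite extend_dim_same.
  - have [e|ne] := pselect (k = n); last by rewrite !extend_dim_other// adde0.
    by subst k; rewrite !extend_dim_same muU.
move=> k A B dA dB AB.
have [e|ne] := pselect (k = n); last by rewrite !extend_dim_other.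
by subst k; rewrite !extend_dim_same; exact: muI.
Qed.

(* The set of isomorphisms may be empty, hence lack the identity; then only
   empty sets can be moved and a Dirac measure is invariant. *)
Lemma measure_of_no_iso n (X : set (n.-tuple S)) :
  (forall f, ~ Iso n f) -> X !=set0 ->
  exists mu : forall k : nat, set (k.-tuple S) -> \bar R,
    [/\ finitely_additive mu, isom_invariant Iso mu & mu n X = 1].
Proof.
move=> noI [x0 Xx0].
apply: (@measure_of_single_dimension _ _ (fun A => (ind A x0)%:R%:E)) => //.
- by rewrite ind0.
- by move=> A B _ _ AB; rewrite indU// natrD EFinD.
- move=> A B _ _ /isomorphic_pieces[K [P [f [_ If AP BP]]]].
  by rewrite AP BP /mult !big1// => a; case: (noI _ (If a)).
- by rewrite ind1.
Qed.

Lemma measure_of_not_dominated n (X : set (n.-tuple S)) :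
  definable X -> Iso n id ->
  ~ (exists k : nat, forall N : nat, dominated Iso
       (fun x => (N * ind X x)%N) (fun x => (k * ind X x)%N)) ->
  exists mu : forall k : nat, set (k.-tuple S) -> \bar R,
    [/\ finitely_additive mu, isom_invariant Iso mu & mu n X = 1].
Proof.
move=> hX Iid /(proper_gains hX Iid)/total_extension[C [pC gC totC]].
have ob A : bounded Iso X A -> order_bounded (zind X) C (zind A).
  by move=> /gains_bounded[k [? ?]]; exists k; split; exact: gC.
pose st := state (zind X) R C.
have b0 : bounded Iso X set0.
  by apply: bounded_subset (bounded_X hX Iid) => //; exact: definable0.
(* The value [+oo] is compatible with additivity because a union of two definable sets is bounded
   exactly when both are. *)
pose mu A := if `[< bounded Iso X A >] then (st (zind A))%:E else +oo.
apply: (@measure_of_single_dimension _ _ mu); rewrite /mu.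
- move=> A dA; case: asboolP => // bA; rewrite lee_fin.
  apply: state_ge0 => //; first exact: ob.
  by apply: gC; exact: gains_nonneg.
- rewrite asboolT//; congr EFin; rewrite -(state0 R pC); congr state.
  by apply/funext => x; rewrite /zind ind0.
- move=> A B dA dB AB; case: asboolP => bAB; last first.
    case: asboolP => bA; last by case: asboolP.
    by case: asboolP => // bB; case: bAB; exact: boundedU.
  have bA : bounded Iso X A by apply: bounded_subset bAB => // x; left.
  have bB : bounded Iso X B by apply: bounded_subset bAB => // x; right.
  rewrite !asboolT// -EFinD -stateD//; try exact: ob.
  congr (state _ _ _ _)%:E; apply/funext => x.
  by rewrite addrfctE /zind /= indU.
- move=> A B dA dB /(isomorphic_bounded X dA dB)[bAB gAB].
  have [bA|nbA] := pselect (bounded Iso X A); last by rewrite !asboolF// -bAB.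
  have bB := bAB.1 bA; rewrite !asboolT//; congr EFin.
  (* With both differences of indicators in the cone, the two states bound each other. *)
  have [/gC gA /gC gB] := gAB bA.
  have obN D : bounded Iso X D -> order_bounded (zind X) C (- zind D).
    by move=> /ob; exact: order_boundedN.
  have := state_ge0 R pC (order_boundedD pC (ob _ bA) (obN _ bB)) gA.
  have := state_ge0 R pC (order_boundedD pC (ob _ bB) (obN _ bA)) gB.
  rewrite !stateD ?stateN//; try by [exact: ob|exact: obN].
  by rewrite /st; lra.
- rewrite asboolT; last exact: bounded_X hX Iid.
  by rewrite /st state_unit.
Qed.
End Measures.

(** * Measures and embeddings *)

Section Counting.
Variables (R : realType) (L : signature) (S : structure L) (Iso : isomorphisms S).
Variables (mu : forall n : nat, set (n.-tuple S) -> \bar R).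
Hypotheses (muA : finitely_additive mu) (muI : isom_invariant Iso mu).
Variable n : nat.
Local Notation T := (n.-tuple S).
Implicit Types (I J K : finType).
Local Open Scope ereal_scope.

Lemma measure_le (A B : set T) : definable A -> definable B -> A `<=` B ->
  mu A <= mu B.
Proof.
case: muA => mu0 _ muU dA dB AB; rewrite -(setDUK AB) muU//; last first.
- by rewrite setDE setICA setICr setI0.
- exact: definableD.
by rewrite leeDl// mu0//; exact: definableD.
Qed.

Lemma measure_bigcup K (D : pred K) (F : K -> set T) :
  (forall a, definable (F a)) -> trivIset [set a | D a] F ->
  mu (\bigcup_(a in [set a | D a]) F a) = \sum_(a | D a) mu (F a).
Proof.
move=> dF tF; case: muA => _ mu0 muU.
have seqE (s : seq K) : uniq s ->
    mu (\bigcup_(a in [set a | (a \in s) && D a]) F a) = \sum_(a <- s | D a) mu (F a).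
  elim: s => [_|a s IH /= /andP[a_s us]].
    by rewrite bigcup_seq_cond !big_nil.
  rewrite big_cons -IH// !bigcup_seq_cond big_cons; case: ifP => // Da.
  rewrite muU// -?bigcup_seq_cond; first exact: definable_bigcup.
  apply/seteqP; split=> // x [Fa [b /andP[bs Db] Fb]].
  have ab : a = b by apply: tF => //; exists x.
  by rewrite ab bs in a_s.
rewrite -seqE ?index_enum_uniq//; congr (mu (bigcup _ _)).
by apply/seteqP; split=> a /=; rewrite mem_index_enum.
Qed.

Lemma measure_image (f : T -> T) (A : set T) :
  Iso n f -> definable A -> mu (f @` A) = mu A.
Proof.
move=> If dA; apply/esym; apply: muI => //; first exact: iso_image_definable If dA.
have [|||||c cE] := @cutting_of_finType _ _ Iso n unit unit (one_copy A) unit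
  (fun=> A) (fun=> tt) (fun=> tt) (fun=> f) => //.
- by move=> [] [].
- by move=> []; apply/seteqP; split=> [x [] //|x Ax]; exists tt.
- by move=> [] [].
exists c => j; rewrite cE; apply/seteqP; split=> [x [_ _]//|x fx].
by exists tt => //; case: j fx.
Qed.

(** Grouped by source, the measures of the pieces add up to the left side; grouped by target, their
    images are disjoint in the summands of [B], and moving preserves measure. *)
Lemma embeds_measure_le I J (A : I -> set T) (B : J -> set T) :
  (forall i, definable (A i)) -> (forall j, definable (B j)) ->
  embeds Iso A B -> \sum_i mu (A i) <= \sum_j mu (B j).
Proof.
move=> dA dB [[N P src tgt f dP If Pd PA fd] /= cB].
have dfP a : definable (f a @` P a) by exact: iso_image_definable.
have -> : \sum_i mu (A i) = \sum_a mu (P a).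
  rewrite (partition_big src xpredT)//=; apply: eq_bigr => i _.
  rewrite -PA (_ : [set a | src a = i] = [set a | src a == i]).
    rewrite measure_bigcup// => a b /= /eqP ai /eqP bi; exact: (Pd i).
  by apply/seteqP; split=> a /= /eqP.
rewrite (partition_big tgt xpredT)//=; apply: lee_sum => j _.
have := cB j; rewrite /cutting_image /=.
rewrite (_ : [set a | tgt a = j] = [set a | tgt a == j]); last first.
  by apply/seteqP; split=> a /= /eqP.
move=> /measure_le-/(_ _ (dB j)) le; apply: le_trans (le _).
  rewrite measure_bigcup//; last by move=> a b /= /eqP aj /eqP bj; exact: (fd j).
  by apply: lee_sum => a _; rewrite measure_image.
exact: definable_bigcup.
Qed.

Lemma sum_copies I (A : I -> set T) (p : nat) (r : I -> R) :
  (forall i, mu (A i) = (r i)%:E) ->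
  \sum_i mu (copies p A i) = (p%:R * \sum_i r i)%:E.
Proof.
move=> Ar; rewrite -(pair_big xpredT xpredT (fun (_ : 'I_p) i => mu (A i)))/=.
have e : \sum_i mu (A i) = (\sum_i r i)%:E.
  by rewrite -sumEFin; apply: eq_bigr => i _.
rewrite (eq_bigr (fun=> (\sum_i r i)%:E)); last by move=> k _; exact: e.
by rewrite sumEFin sumr_const card_ord mulr_natl.
Qed.

(** Let [a] be the total measure of the removed part of 2X and [b] that of the rest. Then
    [a + b = 2] and [b <= 1], so [1 <= a]. But [p * a <= q * 2] gives [p <= 2 * q], against
    [4 * q <= p]. *)
Lemma not_embeds0_of_measure (X : set T) : definable X -> mu X = 1 ->
  ~ embeds0 Iso R (copies 2 (one_copy X)) (one_copy X).
Proof.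
move=> dX X1 emb; have [|A0 [dA0 A0X [p [q [p0 q0 pq A0q]]] A0c]] := emb 4%R.
  by rewrite ltr0n.
have dC i : definable (copies 2 (one_copy X) i `\` A0 i) by exact: definableD.
case: (muA) => mu0 _ muU.
(* Subsets of [X] have finite measure, which lets the computation take place in [R]. *)
have fin_sub (B : set T) : definable B -> B `<=` X -> mu B = (fine (mu B))%:E.
  move=> dB BX; rewrite fineK// ge0_fin_numE ?mu0//.
  by apply: le_lt_trans (measure_le dB dX BX) _; rewrite X1 ltry.
pose r i := fine (mu (A0 i)); pose r' i := fine (mu (X `\` A0 i)).
have muA0 i : mu (A0 i) = (r i)%:E by exact: fin_sub.
have muC i : mu (X `\` A0 i) = (r' i)%:E.
  by apply: fin_sub; [exact: dC|exact: subDsetl].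
have rr' i : (r i + r' i)%R = 1%R.
  by apply: EFin_inj; rewrite EFinD -muA0 -muC -muU ?setDUK//; [exact: dC|rewrite setDIK].
have := embeds_measure_le dC (fun=> dX) A0c.
have := embeds_measure_le (fun i => dA0 i.2) (fun=> dX) A0q.
rewrite (sum_copies p muA0) (@sum_copies _ (copies 2 (one_copy X)) q (fun=> 1%R))//.
rewrite (eq_bigr _ (fun i _ => muC i)) (eq_bigr _ (fun i _ => X1)) !sumEFin !lee_fin.
rewrite !sumr_const card_unit card_prod card_ord card_unit muln1 mulr1n.
have : (\sum_i r i + \sum_i r' i = 2%:R)%R.
  rewrite -big_split/= (eq_bigr _ (fun i _ => rr' i)) sumr_const.
  by rewrite card_prod card_ord card_unit.
move: pq; rewrite ler_pdivlMr ?ltr0n// => pq.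
set a := (\sum_i r i)%R; set b := (\sum_i r' i)%R => ab ple b1.
have a1 : (1 <= a)%R by lra.
have : (p%:R <= p%:R * a :> R)%R by rewrite ler_peMr.
have : (0 < q%:R :> R)%R by rewrite ltr0n.
lra.
Qed.
End Counting.

Theorem theorem1p2 (R : realType) (L : signature) (S : structure L)
    (Iso : isomorphisms S) (n : nat) (X : set (n.-tuple S))
    (hX : definable X) :
  ~ embeds0 Iso R (copies 2 (one_copy X)) (one_copy X)
  <->
  exists mu : forall k : nat, set (k.-tuple S) -> \bar R,
    [/\ finitely_additive mu, isom_invariant Iso mu & mu n X = 1%E].
Proof.
split; last by move=> [mu [muA muI X1]]; exact (not_embeds0_of_measure muA muI hX X1).
move=> nemb; have [noI|hasI] := pselect (forall f, ~ Iso n f).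
  (* An empty [X] would satisfy the excluded relation, since empty families embed even without
     isomorphisms. *)
  apply: measure_of_no_iso => //; apply: contrapT => X0; apply: nemb => m m0.
  have {X0} -> : X = set0 by apply/seteqP; split=> // x Xx; apply: X0; exists x.
  exists (fun=> set0); split=> [_|_ x []||]; first exact: definable0.
    exists (Num.bound m).+1, 1%N; split=> //.
      rewrite divr1; apply/ltW/(lt_trans (archi_boundP (ltW m0))).
      by rewrite ltr_nat.
    by apply: embeds_empty => // j; exact: definable0.
  by apply: embeds_empty => [i|j]; [exact: setD0|exact: definable0].
have Iid : Iso n id.
  by move/existsNP: hasI => [f /contrapT]; exact: iso_id.
apply: (measure_of_not_dominated R hX Iid) => -[k Hk]; apply: nemb => m m0.
have multE p x : mult (copies p (copies 2 (one_copy X))) x = (p * 2 * ind X x)%N.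
  by rewrite mult_const !card_prod !card_ord card_unit muln1.
(* All of 2X is removed, so that nothing remains to be embedded into [X]. *)
exists (copies 2 (one_copy X)); split=> [i|i||].
- exact: hX.
- by [].
(* The quotient is [(Num.bound m).+1], above [m]; [k.+1] keeps the denominator positive when [k] is
   0, and [k] copies of [X] fit into [k.+1] copies of 2X. *)
- exists ((Num.bound m).+1 * k.+1)%N, k.+1; split=> //.
    rewrite natrM mulfK ?pnatr_eq0//; apply: ltW.
    by apply: lt_trans (archi_boundP (ltW m0)) _; rewrite ltr_nat.
  apply: embeds_of_dominated => [i|j|]; [exact: hX|exact: hX|].
  apply: dominated_mono (Hk ((Num.bound m).+1 * k.+1 * 2)%N) => x.
    by rewrite multE.
  by rewrite multE leq_mul2r; lia.
- by apply: embeds_empty => // i; exact: setDv.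
Qed.
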